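(* If $g\in GL(2,\mathbb{Z}[i])$ is of finite order $r$ and $\det(g)=i$, then $$\mathrm{tr}(g)\in\{0,\pm(1+i)\},\qquad r\in\{4,8\}.$$ More precisely, for the eigenvalues $\lambda_1,\lambda_2$ of $g$ (up to a transposition): (i) $\mathrm{tr}(g)=0$ or, equivalently, $\lambda_1=e^{\frac{3\pi i}{4}}$, $\lambda_2=e^{-\frac{\pi i}{4}}$, if and only if $g$ is of order $8$; (ii) if $\mathrm{tr}(g)=1+i$ or, equivalently, $\lambda_1=i$, $\lambda_2=1$, then $g$ is of order $4$; (iii) if $\mathrm{tr}(g)=-1-i$ or, equivalently, $\lambda_1=-i$, $\lambda_2=-1$, then $g$ is of order $4$.
   Context: $GL(2,\mathbb{Z}[i])$ is the group of $2\times2$ matrices over the Gaussian integers $\mathbb{Z}[i]$ with determinant in $\mathbb{Z}[i]^*=\{\pm1,\pm i\}$. *)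

(* Defs.v *)
From HB Require Import structures.
From mathcomp Require Import all_boot all_order all_algebra.
From mathcomp Require Import reals trigo.
From mathcomp Require Import complex.

Set Implicit Arguments.
Unset Strict Implicit.
Unset Printing Implicit Defensive.

Import Order.TTheory GRing.Theory Num.Theory.

Local Open Scope ring_scope.
Local Open Scope complex_scope.

Definition gaussInt (R : realType) : {pred R[i]} :=
  [pred z | (complex.Re z \is a Num.int) && (complex.Im z \is a Num.int)].

(* GL(2, Z[i]) as a set of complex matrices; [:: 1; -1; 'i; - 'i] lists the
   units of Z[i]. *)
Definition GL2Gauss (R : realType) : {pred 'M[R[i]]_2} :=
  [pred g | (g \is a mxOver (@gaussInt R))
            && (\det g \in [:: 1; -1; 'i%C; - 'i%C])].

Definition has_order (T : pzRingType) (x : T) (r : nat) : Prop :=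
  [/\ (0 < r)%N, x ^+ r = 1
    & forall k : nat, (0 < k)%N -> (k < r)%N -> x ^+ k <> 1].

Definition expi (R : realType) (t : R) : R[i] := cos t +i* sin t.

(* s lists all the eigenvalues of g, with algebraic multiplicity; the order of
   the list is irrelevant. *)
Definition eigenvalues_are (F : fieldType) (n : nat) (g : 'M[F]_n) (s : seq F)
    : Prop :=
  char_poly g = \prod_(l <- s) ('X - l%:P).

Arguments gaussInt R : clear implicits.
Arguments GL2Gauss R : clear implicits.
Arguments has_order {T} x r%_N.

(* Main.v *)
Require Import Defs.
From mathcomp Require Import all_boot all_order all_algebra.
From mathcomp Require Import reals trigo.
From mathcomp Require Import complex.
From mathcomp Require Import ring lra zify.
Import Order.TTheory GRing.Theory Num.Theory.
Local Open Scope ring_scope.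
Local Open Scope complex_scope.

(** Let t be the trace of g and l an eigenvalue.  As g has finite order, l is a
    root of unity, so l^-1 is its conjugate, and the other eigenvalue is
    det g / l = i * conj l.  Writing l = x + i y, this gives
    t = l + i * conj l = (x + y)(1 + i), with (x + y)^2 <= 2 because
    x^2 + y^2 = 1 ([finite_order_trace]).  The entries of g being Gaussian
    integers, x + y is an integer, hence 0, 1 or -1: these are the three traces
    ([gauss_trace_values]).

    For the order, g^k = 1 forces i^k = det (g^k) = 1, so 4 divides k
    ([dvdn4_order]).  On the other hand, with d = det g, Cayley-Hamilton gives
    g^4 = t (t^2 - 2 d) g + d^2 - d t^2 ([expr4_mx2]).  For d = i this is -1
    when t = 0 and 1 when t^2 = 2 i, that is when t = 1 + i or t = - 1 - i; so
    the order is 8 and 4 respectively ([has_order8], [has_order4]).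

    The determinant being known, the trace determines the characteristic
    polynomial, and the statements on the eigenvalues follow by checking the sum
    and the product of the listed values ([eigenvalues_are_pair]). *)

Lemma char_poly2 (F : comNzRingType) (A : 'M[F]_2) :
  char_poly A = 'X^2 - (\tr A)%:P * 'X + (\det A)%:P.
Proof.
have lead : (char_poly A)`_2 = 1.
  by have /monicP := char_poly_monic A; rewrite /lead_coef size_char_poly.
apply/polyP => -[|[|[|j]]]; rewrite !(coefD, coefN, coefCM, coefC, coefX, coefXn) /=.
- by rewrite char_poly_det sqrrN expr1n mul1r mulr0 oppr0 !add0r.
- by rewrite (@char_poly_trace _ 2) // mulr1 add0r addr0.
- by rewrite lead mulr0 oppr0 !addr0.
- by rewrite nth_default ?size_char_poly // mulr0 oppr0 !addr0.
Qed.

Lemma eigenvalues_are_pair (F : fieldType) (A : 'M[F]_2) (a b : F) :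
  a * b = \det A -> (\tr A = a + b <-> eigenvalues_are A [:: a; b]).
Proof.
move=> detA; rewrite /eigenvalues_are !big_cons big_nil mulr1 char_poly2 -detA.
have -> : ('X - a%:P) * ('X - b%:P) = 'X^2 - (a + b)%:P * 'X + (a * b)%:P.
  by rewrite polyCD polyCM; ring.
split=> [-> // | /addIr/addrI/oppr_inj/(congr1 (fun p : {poly F} => p`_1))].
by rewrite !coefCM !coefX !mulr1.
Qed.

(** The characteristic polynomial X^2 - t X + d divides
    X^4 - t (t^2 - 2 d) X - (d^2 - d t^2), with cofactor X^2 + t X + t^2 - d:
    the cofactor is chosen to kill the terms in X^3 and X^2.  This one formula
    covers both the traceless case and the case t^2 = 2 d. *)
Lemma expr4_mx2 (F : comNzRingType) (A : 'M[F]_2) :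
  let t := \tr A in let d := \det A in
  A ^+ 4 = (t * (t ^+ 2 - 2%:R * d)) *: A + (d ^+ 2 - d * t ^+ 2)%:M.
Proof.
move=> t d.
have /(congr1 (horner_mx A)) : 'X^4 - (t * (t ^+ 2 - 2%:R * d)) *: 'X
    - (d ^+ 2 - d * t ^+ 2)%:P
    = char_poly A * ('X^2 + t%:P * 'X + (t ^+ 2 - d)%:P).
  rewrite char_poly2 -/t -/d -mul_polyC !(polyCM, polyCB, polyC_exp, polyCMn).
  by ring.
rewrite rmorphM /= Cayley_Hamilton mul0r !rmorphB /= linearZ /= rmorphXn /=.
rewrite !horner_mx_X !horner_mx_C => /eqP.
by rewrite -addrA -opprD subr_eq0 => /eqP.
Qed.

Lemma det_exp (F : comNzRingType) (n : nat) (A : 'M[F]_n.+1) (k : nat) :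
  \det (A ^+ k) = \det A ^+ k.
Proof.
elim: k => [|k IH]; first by rewrite !expr0 det1.
by rewrite !exprS -IH; apply: det_mulmx.
Qed.

Lemma root_char_poly_expr1 (F : fieldType) (n : nat) (A : 'M[F]_n.+1) (k : nat)
    (x : F) :
  A ^+ k = 1 -> root (char_poly A) x -> x ^+ k = 1.
Proof.
move=> Ak; rewrite -eigenvalue_root_char => /eigenvalueP[v vA v0].
have vAj j : v *m A ^+ j = x ^+ j *: v.
  elim: j => [|j IH]; first by rewrite !expr0 mulmx1 scale1r.
  by rewrite !exprSr -mulmxE mulmxA IH -scalemxAl vA scalerA.
have := vAj k; rewrite Ak mulmx1 => /eqP.
rewrite -{1}[v]scale1r -subr_eq0 -scalerBl scaler_eq0 (negPf v0) orbF.
by rewrite subr_eq0 => /eqP.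
Qed.

Lemma has_order_inj (T : pzRingType) (x : T) (r s : nat) :
  has_order x r -> has_order x s -> r = s.
Proof.
move=> [r0 xr rmin] [s0 xs smin]; apply/eqP; rewrite eqn_leq.
by rewrite [(r <= s)%N]leqNgt [(s <= r)%N]leqNgt; apply/andP; split; apply/negP => ?;
  [apply: (rmin s) | apply: (smin r)].
Qed.

Lemma expr_i_eq1 (R : realType) (k : nat) : 'i%C ^+ k = 1 :> R[i] -> (4 %| k)%N.
Proof.
have i4 : 'i%C ^+ 4 = 1 :> R[i] by rewrite (exprM _ 2 2) sqr_i sqrrN expr1n.
rewrite {1}(divn_eq k 4) exprD mulnC exprM i4 expr1n mul1r /dvdn.
have {i4} := ltn_pmod k (isT : (0 < 4)%N).
case: (k %% 4)%N => [|[|[|[|j]]]] //= _; rewrite ?exprS ?expr0 => /eqP;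
 rewrite eq_complex /= => /andP[/eqP h1 /eqP h2]; exfalso; lra.
Qed.

(** Since det is multiplicative, the order of i divides the order of g; this
    leaves only multiples of 4 as candidates when the exact order is sought. *)
Lemma dvdn4_order (R : realType) (g : 'M[R[i]]_2) (k : nat) :
  \det g = 'i%C -> g ^+ k = 1 -> (4 %| k)%N.
Proof.
by move=> detg gk; apply: (expr_i_eq1 R); rewrite -detg -det_exp gk det1.
Qed.

Lemma has_order4 (R : realType) (g : 'M[R[i]]_2) :
  \det g = 'i%C -> (\tr g) ^+ 2 = 2%:R * 'i%C -> has_order g 4.
Proof.
move=> detg trg; split=> // [|k k0 k4 /(dvdn4_order _ _ _ detg)/(dvdn_leq k0)].
  rewrite expr4_mx2 detg trg subrr mulr0 scale0r add0r.
  have -> : 'i%C ^+ 2 - 'i%C * (2%:R * 'i%C) = - ('i%C ^+ 2) :> R[i] by ring.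
  by rewrite sqr_i opprK.
by rewrite leqNgt k4.
Qed.

Lemma has_order8 (R : realType) (g : 'M[R[i]]_2) :
  \det g = 'i%C -> \tr g = 0 -> has_order g 8.
Proof.
move=> detg trg.
have g4 : g ^+ 4 = -1.
  rewrite expr4_mx2 detg trg mul0r scale0r add0r expr0n mulr0 subr0 sqr_i.
  by rewrite raddfN.
split=> // [|k k0 k8 gk]; first by rewrite (exprM _ 4 2) g4 sqrrN expr1n.
have /dvdnP[[|[|q]] kE] := dvdn4_order _ _ _ detg gk; rewrite kE // in k0 k8 gk.
move: gk; rewrite mul1n g4 => /matrixP/(_ 0 0) /eqP.
rewrite !mxE eqxx /= eq_complex /= => /andP[/eqP h _]; exfalso; clear -h; lra.
Qed.

(** Multiplying the quadratic equation by the inverse x - i y of its root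
    x + i y gives t = (x + i y) + i (x - i y). *)
Lemma unit_circle_sum (R : realType) (x y : R) (t : R[i]) : `|x +i* y| = 1 ->
  (x +i* y) ^+ 2 - t * (x +i* y) + 'i%C = 0 ->
  t = (x + y) +i* (x + y) /\ (x + y) ^+ 2 <= 2%:R.
Proof.
move=> norm1 quad.
have conj1 : (x +i* y) * (x -i* y) = 1.
  by have := sqr_normc (x +i* y); rewrite norm1 expr1n.
have xy1 : x ^+ 2 + y ^+ 2 = 1.
  by move: conj1 => /(congr1 (@complex.Re R)) /= <-; ring.
split; last by clear -xy1; have := sqr_ge0 (x - y); nra.
have -> : t = (x +i* y) + 'i%C * (x -i* y).
  apply/eqP; rewrite -subr_eq0 -oppr_eq0 -[X in X == _]mul1r -conj1.
  (* t minus its claimed value lies in the ideal of the two known relations. *)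
  have -> : (x +i* y) * (x -i* y) * - (t - (x +i* y + 'i%C * (x -i* y)))
    = (x -i* y) * ((x +i* y) ^+ 2 - t * (x +i* y) + 'i%C)
      + 'i%C * (x -i* y) * ((x +i* y) * (x -i* y) - 1) by ring.
  by rewrite quad conj1 subrr !mulr0 addr0.
by apply/eqP; rewrite eq_complex /=; apply/andP; split; apply/eqP; ring.
Qed.

Lemma finite_order_trace (R : realType) (g : 'M[R[i]]_2) (r : nat) :
  (0 < r)%N -> g ^+ r = 1 -> \det g = 'i%C ->
  exists2 a : R, \tr g = a +i* a & a ^+ 2 <= 2%:R.
Proof.
move=> r0 gr detg.
have [|[x y] rx] := closed_rootP (char_poly g) _; first by rewrite size_char_poly.
have /eqP : `|x +i* y| ^+ r = 1.
  by rewrite -normrX (root_char_poly_expr1 _ _ _ _ _ gr rx) normr1.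
rewrite pexpr_eq1 // => /eqP norm1.
have quad : (x +i* y) ^+ 2 - \tr g * (x +i* y) + 'i%C = 0.
  by rewrite -[RHS](rootP rx) char_poly2 detg !hornerE.
by have [] := unit_circle_sum _ _ _ _ norm1 quad; exists (x + y).
Qed.

Lemma gauss_trace_values (R : realType) (g : 'M[R[i]]_2) (r : nat) :
  g \in GL2Gauss R -> (0 < r)%N -> g ^+ r = 1 -> \det g = 'i%C ->
  \tr g \in [:: 0; 1 + 'i%C; - (1 + 'i%C)].
Proof.
move=> /andP[/mxOverP gint _] r0 gr detg.
have [a tE a2] := finite_order_trace _ _ _ r0 gr detg.
have /intrP[z az] : a \is a Num.int.
  move: tE; rewrite /mxtrace !big_ord_recl big_ord0 addr0.
  move: (gint ord0 ord0) (gint (lift ord0 ord0) (lift ord0 ord0)).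
  case: (g _ _) => a0 b0; case: (g _ _) => a1 b1 /andP[/= a0int _] /andP[/= a1int _].
  by move=> /(congr1 (@complex.Re R)) /= <-; rewrite rpredD.
have z2 : z ^+ 2 <= 2%:R by rewrite -(ler_int R) rmorphXn /= -az.
have : z \in [:: 0; 1; -1] by rewrite !inE; clear -z2; nia.
rewrite tE az !inE => /or3P[] /eqP ->; apply/or3P;
  [apply: Or31 | apply: Or32 | apply: Or33];
  by rewrite eq_complex /= ?addr0 ?add0r ?oppr0 !eqxx.
Qed.

Lemma expi_add_pi (R : realType) (u : R) : expi (pi + u) = - expi u.
Proof. by apply/eqP; rewrite eq_complex /= !(addrC pi) cosDpi sinDpi !eqxx. Qed.

Lemma expiD (R : realType) (u v : R) : expi (u + v) = expi u * expi v.
Proof.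
by apply/eqP; rewrite eq_complex /= cosD sinD [X in _ && (_ == X)]addrC !eqxx.
Qed.

Theorem proposition17 (R : realType) (g : 'M[R[i]]_2) (r : nat)
    (hg : g \in GL2Gauss R) (hr : has_order g r) (hdet : \det g = 'i%C) :
  (\tr g \in [:: 0; 1 + 'i%C; - (1 + 'i%C)]) /\
  (r \in [:: 4; 8]%N) /\
  ((\tr g = 0 <->
      eigenvalues_are g [:: expi (3%:R * pi / 4%:R); expi (- (pi / 4%:R))]) /\
   (\tr g = 0 <-> has_order g 8)) /\
  ((\tr g = 1 + 'i%C <-> eigenvalues_are g [:: 'i%C; 1]) /\
   (\tr g = 1 + 'i%C -> has_order g 4)) /\
  ((\tr g = - 1 - 'i%C <-> eigenvalues_are g [:: - 'i%C; - 1]) /\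
   (\tr g = - 1 - 'i%C -> has_order g 4)).
Proof.
have [r0 gr _] := hr.
have tr_val := gauss_trace_values _ _ _ hg r0 gr hdet.
have order4_pos : \tr g = 1 + 'i%C -> has_order g 4.
  by move=> tE; apply: has_order4 => //; rewrite tE sqrrD sqr_i; ring.
have order4_neg : \tr g = - 1 - 'i%C -> has_order g 4.
  by move=> tE; apply: has_order4 => //; rewrite tE -opprD sqrrN sqrrD sqr_i; ring.
have order8 : \tr g = 0 -> has_order g 8 by exact: has_order8.
have tr_or : [\/ \tr g = 0, \tr g = 1 + 'i%C | \tr g = - 1 - 'i%C].
  by rewrite -opprD; move: tr_val; rewrite !inE => /or3P[] /eqP;
    [apply: Or31 | apply: Or32 | apply: Or33].
split=> //; split.
  rewrite !inE; case: tr_or => [/order8 | /order4_pos | /order4_neg] ord;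
  by rewrite (has_order_inj _ _ _ _ hr ord).
split; [split | split; split=> //].
  (* The two eigenvalues are opposite, as 3 pi / 4 = pi - pi / 4, so it only
     remains to see that minus the square of expi (- pi / 4) is i. *)
- rewrite (_ : 3%:R * pi / 4%:R = pi + - (pi / 4%:R)) ?expi_add_pi; last by field.
  set w := expi _.
  have w2 : w * - w = \det g.
    rewrite hdet mulrN -expiD (_ : - _ + _ = - (pi / 2%:R)); last by field.
    by apply/eqP; rewrite eq_complex /= cosN sinN cos_pihalf sin_pihalf oppr0 opprK !eqxx.
  by rewrite -(eigenvalues_are_pair _ _ _ _ (etrans (mulrC _ _) w2)) addNr.
- split=> // ord8; case: tr_or => // [/order4_pos | /order4_neg] ord4;
  by have := has_order_inj _ _ _ _ ord8 ord4.
- by rewrite -eigenvalues_are_pair ?hdet ?mulr1 // addrC.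
- by rewrite -eigenvalues_are_pair ?hdet ?mulrNN ?mulr1 // addrC.
Qed.
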